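(* For every integer $n\ge 1$, there is a bijection between the set of $210$-avoiding ascent sequences of length $n$ and the set of $3$-nonnesting set partitions of $[n]=\{1,2,\ldots,n\}$.
   Context: For a sequence of integers $x=x_1x_2\ldots x_m$, $asc(x)$ denotes the number of ascents of $x$, i.e. the number of positions $i$ with $1\le i<m$ and $x_i<x_{i+1}$. An integer sequence $x=x_1\ldots x_n$ is an ascent sequence of length $n$ if $x_1=0$ and $0\le x_i\le asc(x_1x_2\ldots x_{i-1})+1$ for all $2\le i\le n$. It is $210$-avoiding if there are no indices $i<j<k$ with $x_i>x_j>x_k$. The arcs of a set partition $P$ of $[n]$ are the pairs $(i,j)$, $i<j$, such that $i$ and $j$ are consecutive elements (in increasing order) of the same block of $P$; that is, for a block $\{i_1<i_2<\cdots<i_k\}$ the arcs are $(i_1,i_2),(i_2,i_3),\ldots,(i_{k-1},i_k)$. A $k$-nesting is a set of $k$ arcs $(i_1,j_1),\ldots,(i_k,j_k)$ with $i_1<i_2<\cdots<i_k<j_k<\cdots<j_2<j_1$. A set partition is $k$-nonnesting if it has no $k$-nesting. *)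

(* Defs.v *)
From mathcomp Require Import all_boot.

Set Implicit Arguments.
Unset Strict Implicit.
Unset Printing Implicit Defensive.

(* Sequences and [n] are indexed from 0: x_(i+1) is [nth 0 x i], and [n] is
   represented by 'I_n. *)

Definition asc (x : seq nat) : nat :=
  #|[set i : 'I_(size x).-1 | nth 0 x i < nth 0 x i.+1]|.

(* The entries of an ascent sequence are nonnegative, hence the type nat; [ohead]
   also makes the first entry exist, so no ascent sequence is empty. *)
Definition ascent_sequence n (x : n.-tuple nat) : bool :=
  (ohead x == Some 0) &&
  [forall i : 'I_n, (0 < i) ==> (tnth x i <= asc (take i x) + 1)].

Definition avoids_210 n (x : n.-tuple nat) : bool :=
  ~~ [exists i : 'I_n, exists j : 'I_n, exists k : 'I_n,
      [&& i < j, j < k, tnth x i > tnth x j & tnth x j > tnth x k]].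

Definition set_partition n (P : {set {set 'I_n}}) : bool :=
  partition P [set: 'I_n].

Definition arc n (P : {set {set 'I_n}}) (a : 'I_n * 'I_n) : bool :=
  (a.1 < a.2) &&
  [exists B in P, [&& a.1 \in B, a.2 \in B &
                      [forall m in B, ~~ (a.1 < m < a.2)]]].

(* The sorted list is i_1, ..., i_k, j_k, ..., j_1. *)
Definition nesting k n (P : {set {set 'I_n}}) (s : k.-tuple ('I_n * 'I_n)) : bool :=
  all (arc P) s &&
  sorted ltn ([seq val a.1 | a <- s] ++ rev [seq val a.2 | a <- s]).

Definition nonnesting k n (P : {set {set 'I_n}}) : bool :=
  ~~ [exists s : k.-tuple ('I_n * 'I_n), nesting P s].

Definition ascent_sequences_210 n : Type :=
  {x : n.-tuple nat | ascent_sequence x && avoids_210 x}.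

Definition nonnesting_partitions k n : Type :=
  {P : {set {set 'I_n}} | set_partition P && nonnesting k P}.

(* Main.v *)
From mathcomp Require Import all_boot zify.
From Stdlib Require Import FunctionalExtensionality.
Require Import Defs.

Set Implicit Arguments.
Unset Strict Implicit.
Unset Printing Implicit Defensive.

(** Both families are grown one entry at a time, and in both the number of ways
to continue depends on two numbers only.

A set partition is recorded by its link sequence: the entry at i is the
predecessor of i in its block, or i itself when i opens a block.  The arcs are
the entries smaller than their position, and a 3-nesting is a 210 pattern whose
largest entry belongs to an arc.  So both sides are about sequences without 210
patterns.  In such a sequence let M be the largest entry that can serve as the 2
of a pattern, and d the largest one that follows a larger entry of this kind; the
next entry must be at least d.  For link sequences count the p block ends between d
and M and the q block ends above M: the state (p, q) has the children (i, q + 1)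
with i <= p and (p + s, q - s) with s < q.  The last entry of an ascent sequence
is M or d, and repeating it changes nothing; let r be the number of the other
admissible entries below M, and p + 1 the number of those from M on.  The state
(p, r) has the children (p, r), (p - t, r + t + 1) with t <= p and (p + 1, j) with
j < r.

The two trees are not isomorphic; they are compared through walks on integer
partitions with at most two rows.  Let D add a box in all possible ways, D' be
its adjoint, P the projection on shapes with one row, A the addition of a box to
the first row of a one-row shape, and Q = 1 + D + E, where E adds a box to both
rows.  Then
  (1 + D') (1 + D) = (1 + D) (1 + D') + P,    D' Q = Q D' + (1 + A) P,
and (1 + D') (1 + D) = 1 + D' Q because D' E = D.  Pushing D' to the right
through a power shows that one step turns the vector (1 + D)^q (1 + A)^p applied to the empty shape
into the sum of the vectors of the children of (p, q) in the first tree, and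
Q^p (1 + A)^r applied to the empty shape into the sum of the vectors of the
children of (p, r) in the second ([link_value_step], [ascent_value_step]).
Hence the nodes at each level of each tree count walks that start and end at the
empty shape: with steps (1 + D) (1 + D') for set partitions of [n], and with
steps (1 + D') (1 + D), one fewer of them, for ascent sequences of length n.
These numbers agree, since the first removal and the last addition of a closed
walk are void ([closed_walks_agree]). *)

(** * Adding and removing boxes on shapes with at most two rows *)

(** A functional is evaluated at the shape with rows b + c and b, so that every
pair (c, b) is a shape.  The operators on shapes act on functionals by
transposition, which reverses the order of composition. *)
Definition functional := nat -> nat -> nat.

Definition addf (f g : functional) : functional := fun c b => f c b + g c b.

Definition add_box (f : functional) : functional :=
  fun c b => f c.+1 b + (if c is c'.+1 then f c' b.+1 else 0).

Definition remove_box (f : functional) : functional :=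
  fun c b =>
    (if c is c'.+1 then f c' b else 0) + (if b is b'.+1 then f c.+1 b' else 0).

Definition maybe_add f := addf f (add_box f).
Definition maybe_remove f := addf f (remove_box f).

(** Adds at most one box to each row: no box, one box, or one box in each row. *)
Definition add_strip (f : functional) : functional :=
  addf (maybe_add f) (fun c b => f c b.+1).

Definition one_row (f : functional) : functional :=
  fun c b => if b is 0 then f c 0 else 0.

Definition lengthen (f : functional) : functional := fun c b => f c b + f c.+1 b.

(** The pairing of f with the p-th power of [lengthen] applied to the empty
shape, that is the sum of the f i 0 weighted by the binomials of p over i. *)
Definition row_value p (f : functional) := iter p lengthen f 0 0.

Definition at_empty k : functional :=
  fun c b => if c is 0 then (if b is 0 then k else 0) else 0.

Ltac pointwise :=
  apply: functional_extensionality => c; apply: functional_extensionality => b;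
  rewrite /add_strip /maybe_add /maybe_remove /addf /add_box /remove_box
    /one_row /lengthen /at_empty /=.

(** Removing a box after adding one differs from the opposite order only through
the number of addable minus removable boxes.  That number is 1 in Young's
lattice; forbidding a third row loses one addable box exactly when the second row
is not empty, which leaves the identity on one-row shapes. *)
Lemma maybe_add_remove f :
  maybe_add (maybe_remove f) = addf (maybe_remove (maybe_add f)) (one_row f).
Proof. by pointwise; case: c b => [|[|c]] [|b] /=; lia. Qed.

(** The analogue for strips.  Adding a box to both rows and then removing one box
amounts to adding one box; what is left over again lives on one-row shapes. *)
Lemma add_strip_remove f :
  add_strip (remove_box f) = addf (remove_box (add_strip f)) (one_row (lengthen f)).
Proof. by pointwise; case: c b => [|[|c]] [|b] /=; lia. Qed.

(** A step is either the identity, which will account for repeating the last entry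
of an ascent sequence, or the addition of a strip followed by a removal. *)
Lemma maybe_add_remove_strip f :
  maybe_add (maybe_remove f) = addf f (add_strip (remove_box f)).
Proof. by pointwise; case: c b => [|[|c]] [|b] /=; lia. Qed.

Lemma iter_addf op : {morph op : f g / addf f g} ->
  forall n, {morph iter n op : f g / addf f g}.
Proof. by move=> opD; elim=> [|n IH] f g //=; rewrite IH opD. Qed.

Lemma lengthenD : {morph lengthen : f g / addf f g}.
Proof. by move=> f g; pointwise; lia. Qed.

Lemma maybe_addD : {morph maybe_add : f g / addf f g}.
Proof. by move=> f g; pointwise; case: c => [|c]; lia. Qed.

Lemma add_stripD : {morph add_strip : f g / addf f g}.
Proof. by move=> f g; pointwise; case: c => [|c]; lia. Qed.

Lemma row_valueD p : {morph row_value p : f g / addf f g >-> f + g}.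
Proof. by move=> f g; rewrite /row_value (iter_addf lengthenD). Qed.

Lemma row_valueS p f : row_value p.+1 f = row_value p (lengthen f).
Proof. by rewrite /row_value iterSr. Qed.

Lemma maybe_add_at_empty k : maybe_add (at_empty k) = at_empty k.
Proof. by pointwise; case: c b => [|[|c]] [|b] /=; lia. Qed.

Lemma add_strip_at_empty k : add_strip (at_empty k) = at_empty k.
Proof. by pointwise; case: c b => [|[|c]] [|b] /=; lia. Qed.

Lemma row_value_at_empty p k : row_value p (at_empty k) = k.
Proof.
elim: p => // p IH; rewrite row_valueS -[RHS]IH; congr row_value.
by pointwise; case: c b => [|[|c]] [|b] /=; lia.
Qed.

Lemma row_value_one_row p f : row_value p (one_row f) = row_value p f.
Proof.
by elim: p f => // p IH f; rewrite !row_valueS -[LHS]IH -[RHS]IH; congr row_value.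
Qed.

(** Removing a box from the p-th power of 1 + A, where A lengthens the row, lowers
the exponent in all possible ways, by the hockey-stick identity for binomials. *)
Lemma row_value_remove p f :
  row_value p (remove_box f) = \sum_(j < p) row_value j f.
Proof.
elim: p f => [|p IH] f; first by rewrite big_ord0.
rewrite row_valueS big_ord_recl -row_value_one_row.
have -> : one_row (lengthen (remove_box f)) =
    addf (at_empty (f 0 0)) (one_row (remove_box (lengthen f))).
  by pointwise; case: c b => [|[|c]] [|b] /=; lia.
rewrite row_valueD row_value_at_empty row_value_one_row IH; congr (_ + _).
by apply: eq_bigr => j _; rewrite -row_valueS.
Qed.

(** Boxes never leave the second row, so a one-row shape is reached by additions
in the first row only. *)
Lemma row_value_iter_one_row op p q f :
    (forall g, op (one_row g) = one_row (lengthen g)) ->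
  row_value p (iter q op (one_row f)) = row_value (p + q) f.
Proof.
move=> opE; elim: q f => [|q IH] f; first by rewrite addn0 row_value_one_row.
by rewrite iterSr opE IH addnS row_valueS.
Qed.

Lemma maybe_add_one_row f : maybe_add (one_row f) = one_row (lengthen f).
Proof. by pointwise; case: c b => [|[|c]] [|b] /=; lia. Qed.

Lemma add_strip_one_row f : add_strip (one_row f) = one_row (lengthen f).
Proof. by pointwise; case: c b => [|[|c]] [|b] /=; lia. Qed.

(** * Values of the states of the two trees *)

Definition link_value (f : functional) p q := row_value p (iter q maybe_add f).

Definition ascent_value (f : functional) p r := row_value r (iter p add_strip f).

(** Commuting the removal through the q additions leaves one one-row correction
for each addition passed; these are the children (p + s, q - s).  The removal that
reaches the row gives the children with fewer than p, and skipping the removal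
gives the child (p, q + 1). *)
Lemma link_value_step f p q :
  link_value (maybe_remove (maybe_add f)) p q =
    \sum_(i < p.+1) link_value f i q.+1 + \sum_(s < q) link_value f (p + s) (q - s).
Proof.
have: forall g, row_value p (iter q maybe_add (maybe_remove g)) =
    \sum_(i < p.+1) row_value i (iter q maybe_add g) +
    \sum_(s < q) row_value (p + s) (iter (q - s.+1) maybe_add g).
  elim: q => [|q IH] g.
    by rewrite big_ord0 addn0 big_ord_recr /= row_valueD row_value_remove addnC.
  rewrite iterSr maybe_add_remove (iter_addf maybe_addD) row_valueD IH.
  rewrite (row_value_iter_one_row _ _ _ maybe_add_one_row).
  rewrite (big_ord_recr q) /= subnn /= -addnA.
  congr (_ + (_ + _)); apply: eq_bigr => i _; rewrite -iterSr //.
  by rewrite -subSn // ltn_ord.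
move=> valE; rewrite [LHS]/link_value valE.
by congr (_ + _); apply: eq_bigr => i _; rewrite /link_value -iterSr // -subSn.
Qed.

(** The same computation for strips; the first summand is the identity split off
by [maybe_add_remove_strip]. *)
Lemma ascent_value_step f p r :
  ascent_value (maybe_add (maybe_remove f)) p r =
    ascent_value f p r + \sum_(t < p.+1) ascent_value f (p - t) (r + t).+1
    + \sum_(j < r) ascent_value f p.+1 j.
Proof.
rewrite /ascent_value maybe_add_remove_strip (iter_addf add_stripD) row_valueD -addnA.
congr (_ + _); rewrite -iterSr.
have: forall k g, row_value r (iter k add_strip (remove_box g)) =
    \sum_(t < k) row_value (r + t).+1 (iter (k - t.+1) add_strip g) +
    \sum_(j < r) row_value j (iter k add_strip g).
  elim=> [|k IH] g; first by rewrite big_ord0 add0n /= row_value_remove.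
  rewrite iterSr add_strip_remove (iter_addf add_stripD) row_valueD IH.
  rewrite (row_value_iter_one_row _ _ _ add_strip_one_row) -row_valueS.
  rewrite (big_ord_recr k) /= subnn /= addnAC.
  congr (_ + _ + _); apply: eq_bigr => i _; rewrite -iterSr //.
  by rewrite -subSn // ltn_ord.
by move=> ->; congr (_ + _); apply: eq_bigr => t _; rewrite subSS.
Qed.

(** The numbers of walks of n steps from a given shape to the empty one.  A step
removes first in [link_functional] and adds first in [ascent_functional]. *)
Definition link_functional n := iter n (maybe_remove \o maybe_add) (at_empty 1).

Definition ascent_functional n := iter n (maybe_add \o maybe_remove) (at_empty 1).

Lemma link_value0 p q : link_value (link_functional 0) p q = 1.
Proof.
rewrite /link_value; have -> : iter q maybe_add (at_empty 1) = at_empty 1.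
  by elim: q => //= q ->; rewrite maybe_add_at_empty.
by rewrite row_value_at_empty.
Qed.

Lemma ascent_value0 p r : ascent_value (ascent_functional 0) p r = 1.
Proof.
rewrite /ascent_value; have -> : iter p add_strip (at_empty 1) = at_empty 1.
  by elim: p => //= p ->; rewrite add_strip_at_empty.
by rewrite row_value_at_empty.
Qed.

(** Additions and removals alternate in both kinds of walks, so only the grouping
into steps differs; the first removal and the last addition are void in a walk
from the empty shape to itself. *)
Lemma closed_walks_agree n :
  link_value (link_functional n.+1) 0 0 = ascent_value (ascent_functional n) 0 0.
Proof.
have -> : link_functional n.+1 = maybe_remove (ascent_functional n).
  rewrite /link_functional /ascent_functional; elim: n => [|n IH].
    by rewrite /= maybe_add_at_empty.
  by rewrite iterS IH.
by rewrite /link_value /ascent_value /row_value /= /maybe_remove /addf /= addn0.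
Qed.

(** * Generating trees of sequences *)

(** Sequences are stored with the newest entry first, so that a child of u in the
tree is [v :: u] with v among [kids u]. *)
Section Generation.

Variable kids : seq nat -> seq nat.

Fixpoint generation n w : seq (seq nat) :=
  if n is m.+1 then flatten [seq [seq v :: u | v <- kids u] | u <- generation m w]
  else [:: w].

Lemma mem_generationS n w u :
  (u \in generation n.+1 w) =
    if u is v :: u' then (u' \in generation n w) && (v \in kids u') else false.
Proof.
apply/flatten_mapP/idP => [[u' u'n /mapP[v vk ->]]|]; first by rewrite u'n vk.
by case: u => // v u /andP[un vk]; exists u => //; apply/mapP; exists v.
Qed.

Lemma generation_uniq n w : (forall u, uniq (kids u)) -> uniq (generation n w).
Proof.
move=> kids_uniq; elim: n => //= n; elim: (generation n w) => //= u s IH /andP[us /IH {}IH].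
rewrite cat_uniq IH map_inj_uniq ?kids_uniq => [|x y [] //]; rewrite andbT.
apply/hasPn => _ /flatten_mapP[u' u's /mapP[v _ ->]]; apply/mapP => -[v' _ [_ uE]].
by rewrite -uE u's in us.
Qed.

Lemma mem_generation (ok : pred (seq nat)) w :
    (forall u, ok u && (size u == size w) = (u == w)) ->
    (forall v u, size w <= size u -> ok (v :: u) = ok u && (v \in kids u)) ->
  forall n u, (u \in generation n w) = ok u && (size u == n + size w).
Proof.
move=> ok_base ok_step; elim=> [|n IH] u; first by rewrite inE ok_base.
rewrite mem_generationS; case: u => [|v u]; first by rewrite andbF.
rewrite IH /= addSn eqSS andbAC.
by case: eqP => [su|]; rewrite ?andbF // !andbT ok_step // su leq_addl.
Qed.

(** A function that satisfies the recursion of the tree counts descendants. *)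
Lemma size_generation (good : pred (seq nat)) (value : nat -> seq nat -> nat) w :
    good w -> (forall u v, good u -> v \in kids u -> good (v :: u)) ->
    (forall u, good u -> value 0 u = 1) ->
    (forall n u, good u -> value n.+1 u = \sum_(v <- kids u) value n (v :: u)) ->
  forall n, size (generation n w) = value n w.
Proof.
move=> good_w good_kids value0 valueS n.
have good_gen m : {in generation m w, forall u, good u}.
  elim: m => [|m IH] u; first by rewrite inE => /eqP ->.
  by rewrite mem_generationS; case: u => // v u /andP[/IH gu vk]; apply: good_kids.
have sumE m k : \sum_(u <- generation m w) value k u = value (m + k) w.
  elim: m k => [|m IH] k; first by rewrite big_seq1.
  rewrite addSnnS -IH /= big_flatten big_map; apply: eq_big_seq => u /good_gen gu.
  by rewrite big_map -valueS.
rewrite -[n in RHS]addn0 -sumE -sum1_size; apply: eq_big_seq => u /good_gen gu.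
by rewrite value0.
Qed.

End Generation.

(** Turns an encoding by the entries of a duplicate-free list into a bijection
with an ordinal, through which the two families are compared. *)
Lemma encoding_bijective (T : choiceType) (A : pred T) (U : eqType)
    (g : T -> U) (s : seq U) :
    uniq s -> {in A &, injective g} -> {in A, forall x, g x \in s} ->
    (forall u, u \in s -> exists2 x, A x & g x = u) ->
  exists f : {x | A x} -> 'I_(size s), bijective f.
Proof.
move=> s_uniq g_inj g_mem g_surj.
have index_lt (x : {x | A x}) : index (g (sval x)) s < size s.
  by rewrite index_mem g_mem //; apply: (svalP x).
have pre (i : 'I_(size s)) : exists x, A x && (index (g x) s == i).
  have [x Ax gx] := g_surj (tnth (in_tuple s) i) (mem_tnth i (in_tuple s)).
  by exists x; rewrite Ax gx (tnth_nth (g x)) index_uniq ?eqxx.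
pose inv i : {x | A x} := exist _ (xchoose (pre i)) (proj1 (andP (xchooseP (pre i)))).
exists (fun x => Ordinal (index_lt x)), inv => [x|i]; last first.
  by apply: val_inj => /=; apply/eqP; case/andP: (xchooseP (pre i)).
apply: val_inj => /=; case/andP: (xchooseP (pre (Ordinal (index_lt x)))).
move: (xchoose _) => y Ay /eqP /= idx; apply: g_inj => //; first exact: (svalP x).
have xs : g (sval x) \in s by rewrite g_mem //; apply: (svalP x).
by rewrite -[RHS](nth_index (g y) xs) -idx nth_index // g_mem.
Qed.

Lemma sum_nat_down (G : nat -> nat) m n :
  \sum_(m <= v < n) G (n - v.+1) = \sum_(j < n - m) G j.
Proof.
rewrite -{1}[m]add0n big_addn big_mkord (reindex_inj rev_ord_inj) /=.
by apply: eq_bigr => j _; congr G; have := ltn_ord j; lia.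
Qed.

Lemma sum_nat_up (G : nat -> nat) m n :
  \sum_(m <= v < n) G (v - m) = \sum_(j < n - m) G j.
Proof.
rewrite -{1}[m]add0n big_addn big_mkord.
by apply: eq_bigr => j _; rewrite addnK.
Qed.

(** The elements of a set of integers have 0, 1, 2 ... larger elements in it. *)
Lemma sum_rank (a : pred nat) (G : nat -> nat) m n :
  \sum_(v <- iota m n | a v) G (count (fun u => a u && (v < u)) (iota m n)) =
    \sum_(i < count a (iota m n)) G i.
Proof.
elim: n m => [|n IH] m; first by rewrite big_nil big_ord0.
have restE : \sum_(v <- iota m.+1 n | a v)
      G (count (fun u => a u && (v < u)) (iota m n.+1)) =
    \sum_(i < count a (iota m.+1 n)) G i.
  rewrite -IH [LHS]big_seq_cond [RHS]big_seq_cond.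
  apply: eq_bigr => v /andP[]; rewrite mem_iota => /andP[mv _] _ /=.
  by rewrite ltnNge (ltnW mv) andbF.
rewrite [iota m n.+1 in LHS]/= big_cons restE [in RHS]/=; case: ifP => am //.
rewrite add1n big_ord_recr addnC /= ltnn andbF add0n; congr (_ + G _).
by apply: eq_in_count => u; rewrite mem_iota => /andP[-> _]; rewrite andbT.
Qed.

(** * Patterns 210 in sequences stored newest first *)

Definition at_pos w k := nth 0 (rev w) k.

Lemma at_head v w : at_pos (v :: w) (size w) = v.
Proof. by rewrite /at_pos rev_cons nth_rcons size_rev ltnn eqxx. Qed.

Lemma at_behead v w k : k < size w -> at_pos (v :: w) k = at_pos w k.
Proof. by move=> kw; rewrite /at_pos rev_cons nth_rcons size_rev kw. Qed.

(** [top k v] says which entries, v at position k, may be the 2 of a pattern 210: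
all of them in an ascent sequence, only those of arcs in a link sequence. *)
Section Patterns.

Variable top : nat -> nat -> bool.

(** One more than the largest entry admitted by [top], and 0 when there is none,
which must be told apart from a largest entry 0. *)
Fixpoint peak w :=
  if w is v :: u then (if top (size u) v then maxn v.+1 (peak u) else peak u) else 0.

(** The largest entry that follows a larger one admitted by [top], and 0 when there
is none: a new entry completes a pattern 210 if and only if it is smaller. *)
Fixpoint floor w :=
  if w is v :: u then (if v.+1 < peak u then maxn v (floor u) else floor u) else 0.

Fixpoint avoiding w := if w is v :: u then avoiding u && (floor u <= v) else true.

Lemma peakP w x :
  reflect (exists i, [/\ i < size w, top i (at_pos w i) & x < at_pos w i])
          (x.+1 < peak w).
Proof.
apply: (iffP idP).
  elim: w => //= v w IH; have old : x.+1 < peak w -> _ := fun h => IH h.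
  case: ifP => [tv|_].
    rewrite leq_max => /orP[xv|/old[i [iw ti xi]]].
      by exists (size w); rewrite ltnS leqnn at_head.
    by exists i; rewrite at_behead // ltnS ltnW.
  by case/old=> i [iw ti xi]; exists i; rewrite at_behead // ltnS ltnW.
elim: w => [|v w IH] [i [iw ti xi]] //=.
move: iw; rewrite /= ltnS leq_eqVlt => /orP[/eqP ei|iw].
  by move: ti xi; rewrite ei at_head => -> xv; rewrite leq_max ltnS xv.
rewrite at_behead // in ti xi.
have: x.+1 < peak w by apply: IH; exists i.
by case: ifP => // _ h; rewrite leq_max h orbT.
Qed.

Lemma floorP w x :
  reflect (exists i j, [/\ i < j, j < size w, top i (at_pos w i),
                           at_pos w j < at_pos w i & x < at_pos w j])
          (x < floor w).
Proof.
apply: (iffP idP).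
  elim: w => //= v w IH.
  have old : x < floor w -> exists i j, [/\ i < j, j < (size w).+1,
      top i (at_pos (v :: w) i), at_pos (v :: w) j < at_pos (v :: w) i &
      x < at_pos (v :: w) j].
    case/IH=> i [j [ij jw ti ji xj]]; exists i, j.
    have iw := ltn_trans ij jw; rewrite !at_behead //.
    by split=> //; apply: leqW.
  case: ifP => [/peakP[i [iw ti vi]]|_]; last exact: old.
  rewrite leq_max => /orP[xv|]; last exact: old.
  by exists i, (size w); rewrite at_head at_behead.
elim: w => [|v w IH] [i [j [ij jw ti ji xj]]] //=.
move: jw; rewrite /= ltnS leq_eqVlt => /orP[/eqP ej|jw].
  move: ij ti ji xj; rewrite ej => iw; rewrite at_head at_behead // => ti vi xv.
  have -> : v.+1 < peak w by apply/peakP; exists i.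
  by rewrite leq_max xv.
have iw := ltn_trans ij jw; rewrite !at_behead // in ti ji xj.
have: x < floor w by apply: IH; exists i, j.
by case: ifP => // _ h; rewrite leq_max h orbT.
Qed.

Lemma avoidingP w :
  reflect (forall i j k, i < j -> j < k -> k < size w -> top i (at_pos w i) ->
             at_pos w k < at_pos w j -> at_pos w j < at_pos w i -> False)
          (avoiding w).
Proof.
apply: (iffP idP).
  elim: w => //= v w IH /andP[/IH {}IH fv] i j k ij jk.
  rewrite ltnS leq_eqVlt => /orP[/eqP ek|kw].
    subst k; have iw := ltn_trans ij jk; rewrite at_head !at_behead // => ti vj ji.
    by move: fv; rewrite leqNgt => /negP; apply; apply/floorP; exists i, j.
  have jw := ltn_trans jk kw; have iw := ltn_trans ij jw.
  by rewrite !at_behead //; apply: IH jk _.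
elim: w => //= v w IH avoid; apply/andP; split.
  apply: IH => i j k ij jk kw; have jw := ltn_trans jk kw; have iw := ltn_trans ij jw.
  by have := avoid i j k ij jk (ltnW kw); rewrite !at_behead.
rewrite leqNgt; apply/negP => /floorP[i [j [ij jw ti ji vj]]].
have iw := ltn_trans ij jw; have := avoid i j (size w) ij jw (ltnSn _).
by rewrite at_head !at_behead //; apply.
Qed.

Lemma floor_le_pred_peak w : floor w <= (peak w).-1.
Proof.
elim: w => //= v w IH; case: ifP; case: ifP; lia.
Qed.

End Patterns.

(** * Ascent sequences *)

Fixpoint ascents w :=
  if w is v :: u then ascents u + ((u != [::]) && (head 0 u < v)) else 0.

Definition ascent_bound w := if w is [::] then 0 else (ascents w).+1.

Notation value_peak := (peak (fun _ _ => true)).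
Notation value_floor := (floor (fun _ _ => true)).

Definition ascent_kids w :=
  iota (value_floor w) ((ascent_bound w).+1 - value_floor w).

Fixpoint ascent_ok w :=
  if w is v :: u then ascent_ok u && (v \in ascent_kids u) else true.

(** The last entry is the maximum M or else the floor d.  Apart from its
repetition, the admissible entries are in the first case those from d to M - 1 and
those from M + 1 on, in the second case those from d + 1 to M - 1 and those from M
on; the state counts the two groups, the upper one less one. *)
Definition ascent_weight f w :=
  let M := (value_peak w).-1 in
  let slack := (ascents w).+1 - M in
  if head 0 w == M then ascent_value f slack.-1 (M - value_floor w)
  else ascent_value f slack (M - value_floor w).-1.

(** A last entry below the maximum is the 1 of a pattern 21, and the largest such
entry because there is no pattern 210; hence the last clause. *)
Definition ascent_inv w :=
  [&& w != [::], 0 < value_peak w, (value_peak w).-1 <= ascents w &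
    (head 0 w == (value_peak w).-1) || (head 0 w == value_floor w)].

Lemma ascent_inv_kids w v : ascent_inv w -> v \in ascent_kids w -> ascent_inv (v :: w).
Proof.
case/and4P=> w0 M0 Mw hw; rewrite mem_iota => vk.
have fM := floor_le_pred_peak (fun _ _ => true) w.
have bE : ascent_bound w = (ascents w).+1 by case: (w) w0.
rewrite bE in vk.
rewrite /ascent_inv /= w0 /=.
move: hw vk Mw M0 fM; set h := head 0 w; set f := value_floor w; set M := value_peak w.
case: ifP; rewrite /maxn; case: (h < v) / ltnP => hv /=; do ?case: ifP; lia.
Qed.

(** A new entry below M becomes the floor, a new entry above M becomes the
maximum.  The entry equal to the last one leaves the state as it is: it is M in
the first case and d in the second, so the other entries split at different
places in the two cases. *)
Lemma ascent_weightS f w : ascent_inv w ->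
  ascent_weight (maybe_add (maybe_remove f)) w =
    \sum_(v <- ascent_kids w) ascent_weight f (v :: w).
Proof.
case/and4P=> w0 M0 Mw hw.
have fM := floor_le_pred_peak (fun _ _ => true) w.
have bE : ascent_bound w = (ascents w).+1 by case: (w) w0.
set d := value_floor w in fM hw *; set M := (value_peak w).-1 in fM hw Mw.
set A := ascents w in Mw *.
have kidE v : ascent_weight f (v :: w) =
    if v < M then ascent_value f ((A + (head 0 w < v)).+1 - M) (M - maxn v d).-1
    else ascent_value f ((A + (head 0 w < v)).+1 - v).-1 (v - d).
  rewrite /ascent_weight /= w0 -/d -/A /=; case: (ltnP v M) => vM.
    have -> : maxn v.+1 (value_peak w) = M.+1 by lia.
    have -> : v.+1 < value_peak w by lia.
    by rewrite /= (ltn_eqF vM).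
  have -> : maxn v.+1 (value_peak w) = v.+1 by lia.
  have -> : (v.+1 < value_peak w) = false by lia.
  by rewrite /= eqxx.
have -> : \sum_(v <- ascent_kids w) ascent_weight f (v :: w) =
    \sum_(d <= v < A.+2) ascent_weight f (v :: w) by rewrite /ascent_kids bE.
rewrite {1}/ascent_weight -/M -/d -/A; case: eqP hw => [hM _|hM /= /eqP hd].
  rewrite ascent_value_step (big_cat_nat (n := M)) //=; last by lia.
  rewrite [X in _ = _ + X]big_ltn; last by lia.
  have -> : ascent_weight f (M :: w) = ascent_value f (A.+1 - M).-1 (M - d).
    by rewrite kidE ltnn hM ltnn addn0.
  have -> : \sum_(d <= v < M) ascent_weight f (v :: w) =
      \sum_(d <= v < M) ascent_value f (A.+1 - M).-1.+1 (M - v.+1).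
    by apply: eq_big_nat => v /andP[dv vM]; rewrite kidE vM hM; congr ascent_value; lia.
  rewrite (sum_nat_down (ascent_value f _)).
  pose above t := ascent_value f ((A.+1 - M).-1 - t) (M - d + t).+1.
  have -> : \sum_(M.+1 <= v < A.+2) ascent_weight f (v :: w) =
      \sum_(M.+1 <= v < A.+2) above (v - M.+1).
    apply: eq_big_nat => v /andP[Mv vA]; rewrite kidE (_ : v < M = false); last by lia.
    by rewrite hM /above; congr ascent_value; lia.
  rewrite (sum_nat_up above) (_ : A.+2 - M.+1 = (A.+1 - M).-1.+1); last by lia.
  by rewrite addnC addnA.
have {}fM : d < M by lia.
rewrite ascent_value_step big_ltn; last by lia.
rewrite (big_cat_nat (n := M)) //=; last by lia.
have -> : ascent_weight f (d :: w) = ascent_value f (A.+1 - M) (M - d).-1.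
  by rewrite kidE fM hd ltnn addn0 maxnn.
have -> : \sum_(d.+1 <= v < M) ascent_weight f (v :: w) =
    \sum_(d.+1 <= v < M) ascent_value f (A.+1 - M).+1 (M - v.+1).
  by apply: eq_big_nat => v /andP[dv vM]; rewrite kidE vM hd dv; congr ascent_value; lia.
rewrite (sum_nat_down (ascent_value f _)).
pose above t := ascent_value f (A.+1 - M - t) ((M - d).-1 + t).+1.
have -> : \sum_(M <= v < A.+2) ascent_weight f (v :: w) =
    \sum_(M <= v < A.+2) above (v - M).
  apply: eq_big_nat => v /andP[Mv vA]; rewrite kidE (_ : v < M = false); last by lia.
  by rewrite hd (_ : d < v) /above; [congr ascent_value; lia | lia].
rewrite (sum_nat_up above) (_ : A.+2 - M = (A.+1 - M).+1); last by lia.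
by rewrite -addnA; congr (_ + _); rewrite addnC subnS.
Qed.

Lemma size_ascent_generation n :
  size (generation ascent_kids n [:: 0]) = ascent_value (ascent_functional n) 0 0.
Proof.
apply: (size_generation (good := ascent_inv)
  (value := fun n w => ascent_weight (ascent_functional n) w)) => //.
- exact: ascent_inv_kids.
- by move=> u _; rewrite /ascent_weight; case: ifP; rewrite ascent_value0.
- by move=> m u /ascent_weightS <-.
Qed.

Lemma asc_rcons s v : asc (rcons s v) = asc s + ((s != [::]) && (last 0 s < v)).
Proof.
have ascE t : asc t = \sum_(i < (size t).-1) (nth 0 t i < nth 0 t i.+1).
  by rewrite /asc -sum1dep_card big_mkcond; apply: eq_bigr => i _; case: ifP.
case/lastP: s => [|s u]; first by rewrite !ascE !big_ord0.
rewrite !ascE !size_rcons /= big_ord_recr /= last_rcons.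
rewrite -size_eq0 size_rcons !nth_rcons !size_rcons ltnSn !ltnn !eqxx. congr (_ + _).
apply: eq_bigr => i _.
by rewrite ![nth 0 (rcons _ v) _]nth_rcons size_rcons !ltnS ltn_ord (ltnW (ltn_ord i)).
Qed.

Lemma asc_ascents s : asc s = ascents (rev s).
Proof.
elim/last_ind: s => [|s v IH]; first by apply: eq_card0 => -[].
rewrite asc_rcons rev_rcons /= IH; congr (_ + _).
by case/lastP: s {IH} => // s u; rewrite rev_rcons last_rcons -!size_eq0 size_rcons.
Qed.

Lemma mem_ascent_kids w v :
  (v \in ascent_kids w) = (value_floor w <= v) && (v <= ascent_bound w).
Proof. by rewrite mem_iota; lia. Qed.

Lemma ascent_okP w :
  reflect ((forall k, k < size w -> at_pos w k <= ascent_bound (rev (take k (rev w)))) /\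
           avoiding (fun _ _ => true) w) (ascent_ok w).
Proof.
elim: w => [|v w IH]; first by left.
rewrite /= mem_ascent_kids rev_cons; apply: (iffP and3P).
  case=> /IH[bw ->] -> vw; split=> // k; rewrite ltnS leq_eqVlt => /orP[/eqP ->|kw].
    by rewrite at_head -cats1 take_size_cat ?size_rev // revK.
  by rewrite at_behead // -cats1 takel_cat ?size_rev ?(ltnW kw) //; apply: bw.
case=> bw /andP[aw fv]; split=> //; last first.
  by have := bw _ (ltnSn (size w)); rewrite at_head -cats1 take_size_cat ?size_rev // revK.
apply/IH; split=> // k kw; have := bw k (ltnW kw).
by rewrite at_behead // -cats1 takel_cat ?size_rev ?(ltnW kw).
Qed.

Lemma ascent_ok_rev n (x : n.+1.-tuple nat) :
  ascent_sequence x && avoids_210 x = ascent_ok (rev x).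
Proof.
have atE i : at_pos (rev x) i = nth 0 x i by rewrite /at_pos revK.
apply/andP/ascent_okP.
  case=> /andP[x0 /forallP xb] /existsPn xa; split.
    move=> k; rewrite size_rev size_tuple atE revK => kn.
    case: k kn => [|k] kn; first by case: (x) x0 => -[|a s] //= _ /eqP[->].
    have := xb (Ordinal kn); rewrite /= (tnth_nth 0) asc_ascents addn1 /=.
    by case: (rev _) (size_rev (take k.+1 x)) => //; rewrite size_take size_tuple kn.
  apply/avoidingP => i j k ij jk; rewrite size_rev size_tuple => kn _.
  have jn := ltn_trans jk kn; have inn := ltn_trans ij jn.
  rewrite !atE => kj ji; case/negP: (xa (Ordinal inn)).
  apply/existsP; exists (Ordinal jn); apply/existsP; exists (Ordinal kn).
  by rewrite !(tnth_nth 0) /= ij jk ji.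
case=> xb /avoidingP xa; split.
  apply/andP; split.
    have := xb 0; rewrite size_rev size_tuple atE take0 /= leqn0 => /(_ isT).
    by case: (x) => -[|a s] //= _ /eqP ->.
  apply/forallP => i; apply/implyP => i0; have := xb i.
  rewrite size_rev size_tuple ltn_ord atE revK (tnth_nth 0) asc_ascents addn1 => /(_ isT).
  case: (rev _) (size_rev (take i x)) => //; rewrite size_take size_tuple ltn_ord => /= i0'.
  by rewrite -i0' in i0.
apply/existsPn => i; apply/negP => /existsP[j /existsP[k /and4P[ij jk]]].
rewrite !(tnth_nth 0) => ji kj; have kn : k < size (rev x) by rewrite size_rev size_tuple.
by apply: (xa i j k ij jk kn); rewrite ?atE.
Qed.

Lemma ascent_sequences_bijective n :
  exists f : ascent_sequences_210 n.+1 -> 'I_(size (generation ascent_kids n [:: 0])),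
    bijective f.
Proof.
have memE u : (u \in generation ascent_kids n [:: 0]) = ascent_ok u && (size u == n.+1).
  rewrite (mem_generation (ok := ascent_ok)) ?addn1 // => {}u.
  case: u => [|v [|v' u]] //=; rewrite ?andbF ?andbT //; last by rewrite eqseq_cons andbF.
apply: (encoding_bijective
  (A := fun x : n.+1.-tuple nat => ascent_sequence x && avoids_210 x) (g := fun x => rev x)).
- by apply: generation_uniq => u; apply: iota_uniq.
- by move=> x y _ _ xy; apply/val_inj/(can_inj revK).
- by move=> x xA; rewrite memE -ascent_ok_rev size_rev size_tuple eqxx andbT.
move=> u; rewrite memE => /andP[ok_u su].
have su' : size (rev u) == n.+1 by rewrite size_rev.
by exists (Tuple su'); rewrite ?ascent_ok_rev /= revK.
Qed.

(** * Link sequences *)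

(** The left ends of the arcs. *)
Fixpoint openers w :=
  if w is v :: u then (if v < size u then v :: openers u else openers u) else [::].

Notation link_peak := (peak (fun k v => v < k)).
Notation link_floor := (floor (fun k v => v < k)).

(** The block ends that may still be continued. *)
Definition free w v := (link_floor w <= v) && (v \notin openers w).

Definition link_kids w :=
  [seq v <- iota 0 (size w).+1 | (v == size w) || free w v].

Fixpoint link_ok w :=
  if w is v :: u then link_ok u && (v \in link_kids u) else true.

(** All the positions from the peak on are block ends, because no arc starts
there; below the peak the free ones have to be counted. *)
Definition link_weight f w :=
  link_value f (count (free w) (iota 0 (link_peak w))) (size w - link_peak w).

Lemma link_peak_size w : link_peak w <= size w.
Proof. by elim: w => //= v w IH; case: ifP; lia. Qed.

Lemma openers_lt_peak w v : v \in openers w -> v < link_peak w.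
Proof.
elim: w => //= u w IH; case: ifP => // _; rewrite inE leq_max => /orP[/eqP ->|/IH ->].
  by rewrite leqnn.
by rewrite orbT.
Qed.

Lemma peak_opener w : 0 < link_peak w -> (link_peak w).-1 \in openers w.
Proof.
elim: w => //= v w IH; case: ifP => // _ _; rewrite inE.
by case: (leqP (link_peak w) v.+1) => pv /=; rewrite ?eqxx // IH ?orbT //; lia.
Qed.

(** A new block adds a block end above the peak.  An arc from below the peak
becomes the floor, which discards the block ends below its left end.  An arc from
above the peak moves the peak past the block ends that precede its left end. *)
Lemma link_weightS f w :
  link_weight (maybe_remove (maybe_add f)) w =
    \sum_(v <- link_kids w) link_weight f (v :: w).
Proof.
have fM := floor_le_pred_peak (fun k v => v < k) w.
have Ms := link_peak_size w; have oM := @openers_lt_peak w.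
rewrite {1}/link_weight link_value_step.
set M := link_peak w in fM Ms oM *; set p := count _ _; set q := size w - M.
have freeE v : M <= v -> free w v.
  by move=> Mv; rewrite /free; apply/andP; split; [lia | apply/negP => /oM; lia].
have top_kid : link_weight f (size w :: w) = link_value f p q.+1.
  rewrite /link_weight /= ltnn -/M subSn //; congr link_value.
  apply: eq_in_count => v; rewrite mem_iota => vM.
  by rewrite /free /= ltnn (_ : (size w).+1 < _ = false) //; apply/negbTE; rewrite -leqNgt; lia.
have new_peak v : M <= v < size w ->
    link_weight f (v :: w) = link_value f (p + (v - M)) (q - (v - M)).
  case/andP=> Mv vs; rewrite /link_weight /= vs -/M (maxn_idPl _); last by lia.
  have -> : iota 0 v.+1 = iota 0 M ++ iota M (v - M) ++ [:: v].
    have -> : v.+1 = M + (v - M + 1) by lia.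
    by rewrite !iotaD add0n subnKC.
  have fE u : free (v :: w) u = free w u && (u != v).
    rewrite /free /= vs inE negb_or -/M (_ : v.+1 < M = false); last by lia.
    by rewrite -andbA; congr (_ && _); rewrite andbC.
  rewrite !count_cat /= fE eqxx andbF addn0.
  have -> : count (free (v :: w)) (iota 0 M) = p.
    apply: eq_in_count => u; rewrite mem_iota fE => uM.
    by rewrite (_ : u != v) ?andbT //; lia.
  have -> : count (free (v :: w)) (iota M (v - M)) = v - M.
    rewrite -[RHS](size_iota M) -count_predT; apply: eq_in_count => u.
    by rewrite mem_iota fE => uM; rewrite freeE //=; lia.
  by rewrite !addn0; congr link_value; rewrite /q; lia.
have old_kid v : v < M -> free w v ->
    link_weight f (v :: w) =
      link_value f (count (fun u => free w u && (v < u)) (iota 0 M)) q.+1.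
  move=> vM /andP[fv vo].
  (* The largest left end of an arc is not free. *)
  have vM1 : v.+1 < M.
    rewrite ltn_neqAle vM andbT; apply: contra vo => /eqP vE.
    by have := @peak_opener w; rewrite -/M -vE; apply.
  rewrite /link_weight /= (_ : v < size w) -/M; last by lia.
  rewrite (maxn_idPr vM) -/M subSn //.
  congr link_value; apply: eq_in_count => u; rewrite mem_iota => uM.
  rewrite /free /= (_ : v < size w) -/M ?vM1; last by lia.
  by rewrite inE (maxn_idPl fv); case: (u \in openers w); lia.
rewrite /link_kids big_filter (_ : (size w).+1 = M + (q + 1)); last by rewrite /q; lia.
rewrite !iotaD add0n subnKC // !big_cat /= big_cons big_nil eqxx top_kid addn0.
have -> : \sum_(v <- iota 0 M | (v == size w) || free w v) link_weight f (v :: w) =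
    \sum_(i < p) link_value f i q.+1.
  rewrite -(sum_rank (free w) (fun i => link_value f i q.+1)).
  rewrite [LHS]big_seq_cond [RHS]big_seq_cond; apply: eq_big => v.
    rewrite mem_iota add0n; case: (ltnP v M) => //= vM.
    by rewrite (_ : v == size w = false) //; lia.
  rewrite mem_iota => /andP[/= vM]; rewrite (_ : v == size w = false) /=; last by lia.
  exact: old_kid.
have -> : \sum_(v <- iota M q | (v == size w) || free w v) link_weight f (v :: w) =
    \sum_(s < q) link_value f (p + s) (q - s).
  pose G s := link_value f (p + s) (q - s).
  rewrite -(sum_nat_up G) [RHS]big_seq_cond [LHS]big_seq_cond; apply: eq_big => v.
    rewrite !mem_index_iota andbT; case: (boolP (M <= v < size w)) => //=.
    by case/andP=> /freeE ->; rewrite orbT.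
  by rewrite mem_index_iota => /andP[/new_peak].
by rewrite big_ord_recr /= addnA addnAC.
Qed.

Lemma size_link_generation n :
  size (generation link_kids n [::]) = link_value (link_functional n) 0 0.
Proof.
apply: (size_generation (good := predT)
  (value := fun n w => link_weight (link_functional n) w)) => //.
- by move=> u _; rewrite /link_weight link_value0.
- by move=> m u _; rewrite -link_weightS.
Qed.

Lemma mem_openers w x :
  reflect (exists k, [/\ k < size w, at_pos w k < k & at_pos w k = x]) (x \in openers w).
Proof.
apply: (iffP idP).
  elim: w => //= v w IH.
  have old : x \in openers w -> exists k,
      [/\ k < (size w).+1, at_pos (v :: w) k < k & at_pos (v :: w) k = x].
    by case/IH=> k [kw ak ax]; exists k; rewrite at_behead // leqW.
  case: ifP => [vw|_]; last exact: old.
  rewrite inE => /orP[/eqP ->|]; last exact: old.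
  by exists (size w); rewrite at_head.
elim: w => [|v w IH] [k [kw ak ax]] //=.
move: kw; rewrite /= ltnS leq_eqVlt => /orP[/eqP ek|kw].
  by move: ak ax; rewrite ek at_head => -> <-; rewrite inE eqxx.
rewrite at_behead // in ak ax.
have xo : x \in openers w by apply: IH; exists k.
by case: ifP; rewrite // inE xo orbT.
Qed.

Lemma link_okP w :
  reflect [/\ forall k, k < size w -> at_pos w k <= k,
              forall j k, j < k -> k < size w -> at_pos w j < j -> at_pos w k < k ->
                at_pos w j <> at_pos w k &
              avoiding (fun k v => v < k) w]
          (link_ok w).
Proof.
elim: w => [|v w IH]; first by left.
have fM := floor_le_pred_peak (fun k v => v < k) w; have Ms := link_peak_size w.
rewrite /= mem_filter mem_iota add0n /= ltnS; apply: (iffP and3P).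
  case=> /IH[aw ow ->] vk vw; split.
  - move=> k; rewrite ltnS leq_eqVlt => /orP[/eqP ->|kw]; first by rewrite at_head.
    by rewrite at_behead // aw.
  - move=> j k jk; rewrite ltnS leq_eqVlt => /orP[/eqP ek|kw].
      subst k; rewrite at_head at_behead // => aj vlt; move: vk; rewrite (ltn_eqF vlt) /=.
      by case/andP=> _ /negP vo av; apply: vo; apply/mem_openers; exists j.
    by have jw := ltn_trans jk kw; rewrite !at_behead //; apply: ow.
  - case/orP: vk => [/eqP ->|/andP[-> _]] //=; lia.
case=> aw ow /andP[av fv]; have vw : v <= size w.
  by have := aw _ (ltnSn (size w)); rewrite at_head.
split=> //.
  apply/IH; split=> // [k kw|j k jk kw].
    by have := aw k (ltnW kw); rewrite at_behead.
  by have := ow j k jk (ltnW kw); rewrite !at_behead ?(ltn_trans jk kw).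
move: vw; rewrite leq_eqVlt; case: eqP => //= _ vw.
rewrite /free fv; apply/mem_openers => -[j [jw aj ajv]].
by apply: (ow j (size w) jw); rewrite ?at_head ?at_behead.
Qed.

(** * Link sequences of set partitions *)

Lemma mem_pblock_self n (P : {set {set 'I_n}}) x : set_partition P -> x \in pblock P x.
Proof. by move=> Pp; rewrite mem_pblock (cover_partition Pp) inE. Qed.

Lemma arcE n (P : {set {set 'I_n}}) m i : set_partition P ->
  arc P (m, i) =
    [&& m < i, i \in pblock P m & [forall x in pblock P m, ~~ (m < x < i)]].
Proof.
case/and3P=> /eqP coverP trivP _; rewrite /arc /=; congr (_ && _).
apply/exists_inP/andP => [[B BP /and3P[mB iB between]]|[im between]].
  by rewrite (def_pblock trivP BP mB).
have mP : m \in cover P by rewrite coverP inE.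
by exists (pblock P m); rewrite ?pblock_mem // mem_pblock mP im.
Qed.

Lemma pblock_eq n (P : {set {set 'I_n}}) x y :
  set_partition P -> y \in pblock P x -> pblock P y = pblock P x.
Proof. by case/and3P=> _ trivP _; apply: same_pblock. Qed.

Lemma arc_left_unique n (P : {set {set 'I_n}}) m m' i : set_partition P ->
  arc P (m, i) -> arc P (m', i) -> m = m'.
Proof.
move=> Pp; rewrite !arcE // => /and3P[mi im /forall_inP bm] /and3P[mi' im' /forall_inP bm'].
have bE : pblock P m = pblock P m' by rewrite -(pblock_eq Pp im) -(pblock_eq Pp im').
apply: val_inj; have := bm m'; have := bm' m.
rewrite bE -{1}bE !mem_pblock_self // mi mi' => /(_ isT) + /(_ isT).
by rewrite !andbT -!leqNgt => h1 h2; apply/eqP; rewrite eqn_leq h1 h2.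
Qed.

Lemma arc_right_unique n (P : {set {set 'I_n}}) m i i' : set_partition P ->
  arc P (m, i) -> arc P (m, i') -> i = i'.
Proof.
move=> Pp; rewrite !arcE // => /and3P[mi im /forall_inP bm] /and3P[mi' im' /forall_inP bm'].
apply: val_inj; have := bm _ im'; have := bm' _ im; rewrite mi mi' /= -!leqNgt => h1 h2.
by apply/eqP; rewrite eqn_leq h1 h2.
Qed.

Definition predecessor n (P : {set {set 'I_n}}) i : 'I_n :=
  if [pick m | arc P (m, i)] is Some m then m else i.

Lemma arc_predecessor n (P : {set {set 'I_n}}) m i : set_partition P ->
  arc P (m, i) = (m < i) && (predecessor P i == m).
Proof.
move=> Pp; rewrite /predecessor; case: pickP => [m' am'|no_arc].
  apply/idP/andP => [am|[_ /eqP <-] //].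
  by rewrite (arc_left_unique Pp am' am) eqxx; case/andP: am.
by rewrite no_arc; case: eqP => [->|_]; rewrite ?ltnn ?andbF.
Qed.

Lemma predecessor_le n (P : {set {set 'I_n}}) i : predecessor P i <= i.
Proof.
by rewrite /predecessor; case: pickP => // m /andP[/= /ltnW].
Qed.

(** The arc that ends at y starts at the largest smaller element of its block. *)
Lemma exists_arc n (P : {set {set 'I_n}}) (x y : 'I_n) : set_partition P ->
    x < y -> y \in pblock P x ->
  exists m, [/\ arc P (m, y), m \in pblock P x & x <= m].
Proof.
move=> Pp xy yx.
have xx := mem_pblock_self x Pp.
have [|m /andP[mx my] max_m] :=
  @arg_maxnP _ x (fun m => (m \in pblock P x) && (m < y)) val.
  by rewrite xx.
exists m; split=> //; last by apply: max_m; rewrite xx.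
rewrite arcE // my (pblock_eq Pp mx) yx; apply/forall_inP => z zx.
apply/negP => /andP[mz zy]; have := max_m z; rewrite zx zy => /(_ isT).
by rewrite /= leqNgt mz.
Qed.

(** Two elements of a block are joined by a chain of arcs, so the arcs determine
the blocks. *)
Lemma predecessor_inj n (P P' : {set {set 'I_n}}) :
  set_partition P -> set_partition P' -> predecessor P =1 predecessor P' -> P = P'.
Proof.
have sub (Q Q' : {set {set 'I_n}}) : set_partition Q -> set_partition Q' ->
    predecessor Q =1 predecessor Q' ->
    forall y x : 'I_n, x < y -> y \in pblock Q x -> y \in pblock Q' x.
  move=> Qp Q'p QQ' y; have [k] := ubnP (val y); elim: k y => // k IH y yk x xy yx.
  have [m [am mx xm]] := exists_arc Qp xy yx.
  have am' : arc Q' (m, y) by move: am; rewrite !arc_predecessor // QQ'.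
  have my : m < y by case/andP: am.
  move: am'; rewrite arcE // => /and3P[_ ym _].
  move: xm; rewrite leq_eqVlt => /orP[/eqP/val_inj -> //|xm].
  by rewrite -(pblock_eq Q'p (IH m _ x xm mx)) //; apply: leq_trans my _.
have sub2 (Q Q' : {set {set 'I_n}}) : set_partition Q -> set_partition Q' ->
    predecessor Q =1 predecessor Q' -> forall x, {subset pblock Q x <= pblock Q' x}.
  move=> Qp Q'p QQ' x y yx.
  case: (ltngtP x y) => [xy|yx'|/val_inj <-]; last exact: mem_pblock_self.
    exact: (sub Q).
  have := sub _ _ Qp Q'p QQ' _ _ yx'.
  rewrite (pblock_eq Qp yx) mem_pblock_self // => /(_ isT) xy.
  by rewrite (pblock_eq Q'p xy) mem_pblock_self.
move=> Pp P'p PP'.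
rewrite -(equivalence_partition_pblock Pp) -(equivalence_partition_pblock P'p).
apply: eq_imset => x; apply/setP => y; rewrite !inE /=.
by apply/idP/idP; apply: sub2 => // z; rewrite PP'.
Qed.

Definition links n (P : {set {set 'I_n}}) : seq nat :=
  rev [seq val (predecessor P i) | i <- enum 'I_n].

Lemma size_links n (P : {set {set 'I_n}}) : size (links P) = n.
Proof. by rewrite size_rev size_map size_enum_ord. Qed.

Lemma at_links n (P : {set {set 'I_n}}) (i : 'I_n) : at_pos (links P) i = predecessor P i.
Proof. by rewrite /at_pos revK (nth_map i) ?size_enum_ord // nth_ord_enum. Qed.

(** In a 210 pattern with an arc as its 2 the other two entries are arcs as well,
since their positions are larger and their values smaller; in order of position
these arcs go from the innermost to the outermost of a 3-nesting. *)
Lemma link_ok_links n (P : {set {set 'I_n}}) : set_partition P ->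
  link_ok (links P) = nonnesting 3 P.
Proof.
move=> Pp; have arc_at (i : 'I_n) : at_pos (links P) i < i -> arc P (predecessor P i, i).
  by rewrite at_links arc_predecessor // eqxx andbT.
apply/link_okP/existsPn.
  case=> _ _ /avoidingP avoid s; apply/negP; case/andP.
  case: s => -[|[i1 j1] [|[i2 j2] [|[i3 j3] [|? ?]]]] //= _.
  rewrite !arc_predecessor // => /and4P[/andP[_ /eqP p1] /andP[_ /eqP p2] /andP[_ /eqP p3] _].
  rewrite /rev /= => /and5P[i12 i23 ij3 j32 /andP[j21 _]].
  by apply: (avoid j3 j2 j1 j32 j21); rewrite ?size_links // !at_links ?p1 ?p2 ?p3.
move=> no_nest; split.
- move=> k; rewrite size_links => kn; rewrite (at_links P (Ordinal kn)); exact: predecessor_le.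
- move=> j k jk; rewrite size_links => kn; have jn := ltn_trans jk kn.
  move=> /(arc_at (Ordinal jn)) aj /(arc_at (Ordinal kn)) ak.
  rewrite (at_links P (Ordinal jn)) (at_links P (Ordinal kn)) => /val_inj jkE.
  by rewrite jkE in aj; have [jkE'] := arc_right_unique Pp aj ak; rewrite jkE' ltnn in jk.
apply/avoidingP => i j k ij jk; rewrite size_links => kn.
have jn := ltn_trans jk kn; have i_n := ltn_trans ij jn.
rewrite (at_links P (Ordinal kn)) (at_links P (Ordinal jn)) (at_links P (Ordinal i_n)).
move=> ai pkj pji.
have aj := ltn_trans pji (ltn_trans ai ij); have ak := ltn_trans pkj (ltn_trans aj jk).
have := no_nest [tuple (predecessor P (Ordinal kn), Ordinal kn);
  (predecessor P (Ordinal jn), Ordinal jn); (predecessor P (Ordinal i_n), Ordinal i_n)].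
rewrite /nesting /= !arc_predecessor // !eqxx /rev /= ai aj ak ij jk pkj pji.
by [].
Qed.

(** Conversely, the blocks are the classes of the elements from which the links
lead to the same fixed point. *)
Section PartitionOfLinks.

Variables (n : nat) (prev : 'I_n -> 'I_n).
Hypothesis prev_le : forall i, prev i <= i.
Hypothesis prev_inj : forall i j, prev i < i -> prev j < j -> prev i = prev j -> i = j.

(** Links go downwards, so n of them are enough to reach a fixed point. *)
Definition root i := iter n prev i.

Definition partition_of := preim_partition root [set: 'I_n].

Lemma root_fixed i : prev (root i) = root i.
Proof.
have down k : prev (iter k prev i) = iter k prev i \/ iter k prev i <= i - k.
  elim: k => [|k [IH|IH]] /=; first by right; rewrite subn0.
    by left; rewrite !IH.
  move: (prev_le (iter k prev i)); rewrite leq_eqVlt => /orP[/eqP/val_inj fx|lt_k].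
    by left; rewrite !fx.
  by right; lia.
case: (down n) => // le0; apply: val_inj; have := prev_le (root i); have := ltn_ord i.
by rewrite /root /=; lia.
Qed.

Lemma root_prev i : root (prev i) = root i.
Proof. by rewrite /root -iterSr /= -/(root i) root_fixed. Qed.

Lemma root_le i : root i <= i.
Proof.
have le k : iter k prev i <= i by elim: k => //= k; apply: leq_trans (prev_le _).
exact: le.
Qed.

Lemma prev_lt_root (i m : 'I_n) : m < i -> root m = root i -> prev i < i.
Proof.
move=> mi rE; rewrite ltn_neqAle prev_le andbT; apply/negP => /eqP/val_inj fx.
have ri : root i = i by apply: iter_fix.
by have := root_le m; rewrite rE ri leqNgt mi.
Qed.

(** If m lies between [prev i] and i in the same class, then [prev m] is not
[prev i] by injectivity.  If it is larger, it is another counterexample for i; if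
it is smaller, then [prev i] is a counterexample for m, which is smaller than i. *)
Lemma prev_consecutive (i m : 'I_n) : prev i < m -> m < i -> root m != root i.
Proof.
have [k] := ubnP (val i); elim: k i m => // k IH i m ik.
have [l] := ubnP (val m); elim: l m => // l IHm m ml pm mi; apply/eqP => rE.
have rp := root_prev i.
have pm_lt : prev m < m by apply: prev_lt_root pm _; rewrite rp rE.
case: (ltngtP (prev m) (prev i)) => [pmi|pim|/val_inj pE].
- have mk : m < k by apply: leq_trans mi _.
  by have := IH m (prev i) mk pmi pm; rewrite rp rE eqxx.
- have lm : prev m < l by apply: leq_trans pm_lt _.
  have := IHm (prev m) lm pim (ltn_trans pm_lt mi).
  by rewrite root_prev rE eqxx.
by have mE := prev_inj pm_lt (ltn_trans pm mi) pE; rewrite mE ltnn in mi.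
Qed.

Lemma set_partition_of : set_partition partition_of.
Proof. exact: preim_partitionP. Qed.

Lemma predecessor_partition_of i : predecessor partition_of i = prev i.
Proof.
have pblockE x y : (y \in pblock partition_of x) = (root x == root y).
  by rewrite pblock_equivalence_partition ?inE // => ? ? ? _ _ _; split=> // /eqP ->.
have prev_arc : prev i < i -> arc partition_of (prev i, i).
  move=> lt_i; rewrite arcE ?set_partition_of // lt_i pblockE root_prev eqxx.
  apply/forall_inP => x; rewrite pblockE root_prev => /eqP rx.
  by apply/negP => /andP[px xi]; have := prev_consecutive px xi; rewrite rx eqxx.
rewrite /predecessor; case: pickP => [m am|no_arc].
  have := am; rewrite arcE ?set_partition_of // => /and3P[mi + _].
  rewrite pblockE => /eqP rm; have lt_i := prev_lt_root mi rm.
  exact: arc_left_unique set_partition_of am (prev_arc lt_i).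
apply: val_inj; apply/eqP; rewrite eqn_leq prev_le andbT leqNgt; apply/negP => /prev_arc.
by rewrite no_arc.
Qed.

End PartitionOfLinks.

Lemma links_surj n w : link_ok w -> size w = n ->
  exists2 P : {set {set 'I_n}}, set_partition P & links P = w.
Proof.
move=> /link_okP[w_le w_inj _] sw.
have lt_n (i : 'I_n) : at_pos w i < n by apply: leq_ltn_trans (w_le i _) _; rewrite ?sw.
pose prev (i : 'I_n) := Ordinal (lt_n i).
have prev_le i : prev i <= i by rewrite /= w_le // sw.
have prev_inj i j : prev i < i -> prev j < j -> prev i = prev j -> i = j.
  move=> /= pi pj [pE]; apply: val_inj; case: (ltngtP i j) => // ij.
    by case: (w_inj i j ij); rewrite ?sw.
  by case: (w_inj j i ij); rewrite ?sw.
exists (partition_of prev); first exact: set_partition_of.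
apply: (can_inj revK); apply: (@eq_from_nth _ 0) => [|k];
  rewrite size_rev size_links ?size_rev //.
move=> kn; rewrite -[LHS]/(at_pos (links _) (Ordinal kn)) at_links.
by rewrite (predecessor_partition_of prev_le prev_inj).
Qed.

Lemma nonnesting_partitions_bijective n :
  exists f : nonnesting_partitions 3 n -> 'I_(size (generation link_kids n [::])),
    bijective f.
Proof.
have memE u : (u \in generation link_kids n [::]) = link_ok u && (size u == n).
  rewrite (mem_generation (ok := link_ok)) ?addn0 // => {}u.
  by case: u => //= v u; rewrite andbF.
apply: (encoding_bijective
  (A := fun P : {set {set 'I_n}} => set_partition P && nonnesting 3 P) (g := @links n)).
- by apply: generation_uniq => u; apply/filter_uniq/iota_uniq.
- move=> P P' /andP[Pp _] /andP[P'p _] PP'; apply: predecessor_inj => // i.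
  by apply: val_inj; rewrite /= -!at_links PP'.
- by move=> P /andP[Pp ok_P]; rewrite memE link_ok_links // ok_P size_links eqxx.
move=> u; rewrite memE => /andP[ok_u /eqP su].
have [P Pp PE] := links_surj ok_u su.
by exists P; rewrite // Pp -link_ok_links // PE.
Qed.

(** * The bijection *)

Theorem theorem3p7 (n : nat) (hn : 1 <= n) :
  exists f : ascent_sequences_210 n -> nonnesting_partitions 3 n, bijective f.
Proof.
case: n hn => // n _.
have [f f_bij] := ascent_sequences_bijective n.
have [g [h gK hK]] := nonnesting_partitions_bijective n.+1.
move: f f_bij g h gK hK.
rewrite size_ascent_generation size_link_generation closed_walks_agree.
move=> f f_bij g h gK hK.
by exists (h \o f); apply: bij_comp => //; exists g.
Qed.
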